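(* Let $\alpha>0$. Assume that $u_0\in\mathcal C^2(\mathbb T)$ and that there exists $\epsilon>0$ such that $u_0(x)\ge\epsilon$ for any $x\in\mathbb T$. Then there exists $T>0$ such that $$\lim_{n\to\infty}\sup_{x\in\mathbb T_n}\sup_{0\le t\le T}\big|u^n_t(x)-u(t,\tfrac xn)\big|=0,$$ where $\{u(t,x);t\ge0,x\in\mathbb T\}$ is the solution of $$\partial_tu=\partial_x\big(u^{-2}\partial_xu\big),\qquad u(0,\cdot)=u_0(\cdot).$$
   Context: $\mathbb T=\mathbb R/\mathbb Z$ and $\mathbb T_n=\mathbb Z/n\mathbb Z$, embedded in $\mathbb T$ by $x\mapsto x/n$. Let $\phi(\rho)=\rho/(1+\rho)$, $\phi_n(u)=n^\alpha\phi(n^\alpha u)$ for $u\ge0$, and for $f:\mathbb T_n\to\mathbb R$ let $\Delta_nf(x)=n^2(f(x+1)+f(x-1)-2f(x))$. For each $n\in\mathbb N$, $\{u^n_t(x);t\ge0,x\in\mathbb T_n\}$ is the (unique, global) solution of the system of ODEs $\frac{d}{dt}u^n_t(x)=\Delta_n\phi_n(u^n_t(x))$ with initial data $u^n_0(x)=u_0(\frac xn)$. *)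

(* Defs.v *)
From HB Require Import structures.
From mathcomp Require Import all_boot all_order all_algebra.
From mathcomp Require Import all_classical all_reals all_analysis.
Set Implicit Arguments.
Unset Strict Implicit.
Unset Printing Implicit Defensive.
Import Order.TTheory GRing.Theory Num.Theory.
Import numFieldNormedType.Exports.
Local Open Scope ring_scope.
Local Open Scope classical_set_scope.

(* A function on the circle R/Z is a 1-periodic function on R; the discrete
   circle Z/nZ is 'I_n, with the cyclic successor [ordS] as x |-> x + 1 and the
   cyclic predecessor [ord_pred] as x |-> x - 1. *)

Section Definitions.
Context {R : realType}.
Implicit Types (n : nat) (alpha : R).

Definition phi (rho : R) : R := rho / (1 + rho).

Definition phin alpha n (u : R) : R :=
  n%:R `^ alpha * phi (n%:R `^ alpha * u).

Definition laplacian n (f : 'I_n -> R) (x : 'I_n) : R :=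
  n%:R ^+ 2 * (f (ordS x) + f (ord_pred x) - 2 * f x).

Definition embed n (x : 'I_n) : R := (x : nat)%:R / n%:R.

Definition C2 (f : R -> R) : Prop :=
  [/\ forall x : R, derivable f x 1,
      forall x : R, derivable f^`() x 1
    & continuous f^`()^`()].

(* Nonnegativity is part of the notion of solution because [phin alpha n] is
   only considered on [0, +oo[.  At t = 0 only continuity is asked; the
   equation then holds there too, with the right derivative. *)
Definition ode_solution alpha n (u0 : R -> R) (v : R -> 'I_n -> R) : Prop :=
  [/\ forall (t : R) x, 0 <= t -> 0 <= v t x,
      forall x, {within `[0, +oo[, continuous (v ^~ x)},
      forall (t : R) x, 0 < t ->
        is_derive t (1 : R) (v ^~ x) (laplacian (fun y => phin alpha n (v t y)) x)
    & forall x, v 0 x = u0 (embed x)].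

(* Regularity class C^{1,2} on ]0, +oo[ x R: the derivatives u_t, u_x and u_xx
   exist and are jointly continuous. *)
Definition C12 (u : R -> R -> R) : Prop :=
  (forall (t : R) x, 0 < t ->
     [/\ derivable (u ^~ x) t 1, derivable (u t) x 1
       & derivable (u t)^`() x 1]) /\
  (forall p : R * R, 0 < p.1 ->
     [/\ {for p, continuous (fun q : R * R => (u ^~ q.2)^`() q.1)},
         {for p, continuous (fun q : R * R => (u q.1)^`() q.2)}
       & {for p, continuous (fun q : R * R => (u q.1)^`()^`() q.2)}]).

(* Classical solution of u_t = (u^{-2} u_x)_x on [0, +oo[ x R/Z with
   u(0, .) = u0.  Positivity is what gives a meaning to u^{-2}. *)
Definition pde_solution (u0 : R -> R) (u : R -> R -> R) : Prop :=
  [/\ forall t : R, 0 <= t -> periodic (u t) 1,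
      forall (t : R) x, 0 <= t -> 0 < u t x,
      {within [set p : R * R | 0 <= p.1],
         continuous (fun p : R * R => u p.1 p.2)} /\ C12 u,
      forall (t : R) x, 0 < t ->
        (u ^~ x)^`() t = (fun y => u t y ^- 2 * (u t)^`()%classic y)^`() x
    & forall x, u 0 x = u0 x].

End Definitions.

(* Main.v *)
Require Import Defs.
From HB Require Import structures.
From mathcomp Require Import all_boot all_order all_algebra.
From mathcomp Require Import all_classical all_reals all_analysis.
From mathcomp Require Import ring lra.
Import Order.TTheory GRing.Theory Num.Theory.
Import numFieldNormedType.Exports.
Local Open Scope ring_scope.
Local Open Scope classical_set_scope.

Set Implicit Arguments.
Unset Strict Implicit.
Unset Printing Implicit Defensive.

(** Set w = u^n + n^-alpha.  Since phi_n(v) = n^alpha - 1 / (v + n^-alpha), the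
    lattice equation becomes w' = Delta_n (-1/w): it is the finite difference
    scheme of u_t = (-1/u)_xx, which is the limit equation, and the only trace of
    alpha is a vanishing shift of the initial condition.  The scheme is monotone,
    so strict super- and subsolutions compare ([discrete_comparison]).

    Barriers are built from the limit u itself.  The flux -1/u is homogeneous of
    degree -1, hence u |-> l u(t / l^2, x) preserves the equation for each
    constant l > 0.  Letting l depend on time, l(t) = 1 + eta (1 + t), and running
    u along the clock tau with tau' = l^-2, the function
        v(t, x) = l(t) u(delta + tau(t), x)
    satisfies v_t - (-1/v)_xx = eta u, so that it is a strict supersolution for
    eta > 0 and a strict subsolution for eta < 0 ([is_derive_rescaled]).  On the
    lattice this margin absorbs the discretization error: a second difference of
    -1/u is a value of (-1/u)_xx = u_t at a point at distance at most 1/n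
    ([laplacian_pressure]), and u_t is uniformly continuous on [delta, 5] x [-1, 2],
    so the error is below the margin once n is large ([rescaled_strict]).

    Starting the barrier at the positive time delta avoids the initial layer,
    where u is only continuous.  The initial conditions are still ordered, since
    u(delta, .) is uniformly close to u_0 while l(0) = 1 + eta leaves a room of
    order eta.  Hence w is squeezed between the barriers with parameters eta and
    - eta, and both are uniformly close to u when eta and delta are small.  Any
    time interval [0, T] would do, with eta small compared with 1/T; below T = 1. *)

(** * Uniform continuity, mean values and first contact *)

(** Heine's theorem, for a function continuous relatively to the compact set. *)
Lemma compact_unif_continuous (R : realType) (T : pseudoMetricType R)
    (f : T -> R) (K : set T) (e : R) :
  compact K -> {within K, continuous f} -> 0 < e ->
  exists2 d : R, 0 < d &
    forall p q, K p -> K q -> ball p d q -> `|f p - f q| < e.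
Proof.
move=> /compact_near_coveringP/near_covering_withinP cK /subspace_continuousP fK e0.
have : \forall d \near 0^'+, K `<=` (fun p => forall q, K q -> ball p d q ->
    `|f p - f q| < e).
  apply: cK => p Kp.
  have e20 : 0 < e / 2 by rewrite divr_gt0.
  have /cvgrPdist_lt/(_ _ e20)/nbhs_ballP[r /= r0 hr] := fK p Kp.
  near=> p' d => Kp' q Kq p'q.
  have pp' : ball p (r / 2) p'.
    by near: p'; apply: nbhsx_ballx; rewrite divr_gt0.
  have dr : d <= r / 2.
    by near: d; apply: nbhs_right_le; rewrite divr_gt0.
  have h1 : `|f p - f p'| < e / 2.
    by apply: hr => //; apply: (le_ball _ pp'); lra.
  have h2 : `|f p - f q| < e / 2.
    apply: hr => //; apply: ball_split pp' _.
    by apply: (le_ball _ p'q).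
  rewrite (_ : f p' - f q = (f p - f q) - (f p - f p')); last by ring.
  by rewrite (le_lt_trans (ler_normB _ _))// [ltRHS]splitr ltrD.
move=> /(filterI (nbhs_right_gt 0)) /filter_ex[d [d0 hd]].
by exists d => // p q Kp; exact: hd.
Unshelve. all: end_near. Qed.

(** With a mean value in place of a Taylor expansion, the consistency error of
    the scheme is an oscillation of q'' over a distance h. *)
Lemma second_difference_mean_value (R : realType) (q q' q'' : R -> R) (x h : R) :
  0 < h -> (forall y : R, is_derive y (1 : R) q (q' y)) ->
  (forall y : R, is_derive y (1 : R) q' (q'' y)) ->
  exists2 xi, `|xi - x| <= h & q (x + h) + q (x - h) - 2 * q x = h ^+ 2 * q'' xi.
Proof.
move=> h0 dq dq'.
pose c := (q (x + h) + q (x - h) - 2 * q x) / h ^+ 2.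
(* The constant c makes G vanish at h as well as at 0; Rolle for G and the mean
   value theorem for q' on [x - s, x + s] then conclude. *)
pose G s := q (x + s) + q (x - s) - c * s ^+ 2.
have dG (s : R) : is_derive s (1 : R) G (q' (x + s) - q' (x - s) - c * (2 * s)).
  have e1 : is_derive s (1 : R) (fun s => q (x + s)) (q' (x + s)).
    by apply: (is_derive_eq (is_derive1_comp (dq _) _)); rewrite add0r mulr1.
  have e2 : is_derive s (1 : R) (fun s => q (x - s)) (- q' (x - s)).
    by apply: (is_derive_eq (is_derive1_comp (dq _) _)); rewrite add0r mul1r mulrN1.
  rewrite /G; apply: is_derive_eq.
  rewrite /GRing.scale/=; ring.
have cont_of (f f' : R -> R) (A : set R) :
    (forall y : R, is_derive y (1 : R) f (f' y)) -> {within A, continuous f}.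
  move=> df; apply: continuous_subspaceT => y.
  by apply/differentiable_continuous/derivable1_diffP; case: (df y).
have hn0 : h != 0 by rewrite gt_eqF.
have [||s] := @Rolle R G 0 h h0 (fun s _ => @ex_derive _ _ _ _ _ _ _ (dG s)).
- exact: cont_of dG.
- by rewrite /G /c addr0 subr0; field.
rewrite in_itv/= => /andP[s0 sh] [_ Gs].
have [_ Gs'] := dG s; rewrite Gs in Gs'.
have [xi] := @MVT R q' q'' (x - s) (x + s) ltac:(lra) (fun y _ => dq' y)
  (cont_of _ _ _ dq').
rewrite in_itv/= => /andP[x1 x2] qxi.
exists xi; first by rewrite ler_norml; lra.
have : q'' xi = c.
  have s2 : 2 * s != 0 by rewrite mulf_neq0// gt_eqF.
  apply: (mulIf s2); apply/eqP; rewrite -subr_eq0; apply/eqP.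
  by rewrite Gs' qxi; ring.
by move=> ->; rewrite /c mulrCA divff ?mulr1// expf_neq0.
Qed.

(** At the first time s when some component vanishes, all the others are
    nonnegative, so the hypothesis makes that component increasing at s; but it
    was positive before s. *)
Lemma first_touching (R : realType) (I : finType) (T : R) (D dD : R -> I -> R) :
  (forall i, {within `[0, T], continuous (D ^~ i)}) ->
  (forall i, 0 < D 0 i) ->
  (forall (t : R) i, 0 < t <= T -> is_derive t (1 : R) (D ^~ i) (dD t i)) ->
  (forall t i, 0 < t <= T -> (forall j, 0 <= D t j) -> D t i = 0 ->
     0 < dD t i) ->
  forall t i, 0 <= t <= T -> 0 < D t i.
Proof.
move=> Dc D0 Dd Dt t i /andP[t0 tT].
rewrite ltNge; apply/negP => Dti.
pose B := [set s | 0 <= s <= T /\ exists j, D s j <= 0].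
have Bt : B t by split; [rewrite t0 tT|exists i].
have lB : lbound B 0 by move=> s [/andP[]].
have hB : has_inf B by split; [exists t|exists 0].
set s := inf B.
have s0 : 0 <= s by apply: lb_le_inf => //; exists t.
have sT : s <= T by apply: le_trans tT; apply: ge_inf => //; case: hB.
have below r j : 0 <= r -> r < s -> 0 < D r j.
  move=> r0 rs; rewrite ltNge; apply/negP => Drj.
  have : B r by split; [rewrite r0 (le_trans (ltW rs))|exists j].
  by move=> /(ge_inf hB.2); rewrite -/s leNgt rs.
have cs j : D ^~ j @ within `[0, T] (nbhs s) --> D s j.
  by have /subspace_continuousP := Dc j; apply; rewrite /= in_itv/= s0 sT.
have [j Dsj] : exists j, D s j <= 0.
  apply: contrapT => /forallNP Ds.
  have : \forall r \near within `[0, T] (nbhs s), forall j, 0 < D r j.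
    apply: filter_forall => j; apply: (cvgr_gt (D s j)) => //.
    by rewrite ltNge; apply/negP/Ds.
  move=> [e /= e0 he].
  have [r [/andP[r0 rT] [j Drj]] rse] := inf_adherent e0 hB.
  have sr : s <= r by apply: ge_inf; [exact: hB.2|split; [rewrite r0|exists j]].
  suff : 0 < D r j by rewrite ltNge Drj.
  apply: he; rewrite /= ?in_itv/= ?r0//.
  by rewrite distrC ger0_norm ?subr_ge0// ltrBlDl.
have sp : 0 < s.
  by rewrite lt_neqAle s0 andbT; apply/eqP => E; move: Dsj; rewrite -E leNgt D0.
have near_left : \forall r \near s^'-, 0 < r /\ r < s.
  by near=> r; split; near: r; [exact: nbhs_left_gt|exact: nbhs_left_lt].
have Ds_ge0 k : 0 <= D s k.
  have ck : D ^~ k @ s^'- --> D s k.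
    have [/derivable1_diffP/differentiable_continuous dk _] := Dd s k ltac:(by rewrite sp).
    exact: cvg_at_left_filter.
  apply: (cvgr_to_ge ck); near=> r; apply/ltW.
  have [] : 0 < r /\ r < s by near: r.
  by move=> r0; apply: below; rewrite ltW.
have Dsj0 : D s j = 0 by apply/eqP; rewrite eq_le Dsj Ds_ge0.
have dpos : 0 < dD s j by apply: Dt; rewrite ?sp.
have [ds dsE] := Dd s j ltac:(by rewrite sp).
have := cvg_dnbhs_at_left ds; rewrite -/('D_1 (D ^~ j) s) dsE.
move=> /cvgr_gt/(_ 0 dpos) near_pos.
have [h []] : exists h, h < 0 /\ - s < h /\ 0 < h^-1 *: (D (h *: 1 + s) j - D s j).
  apply: (@filter_ex _ (0 : R)^'-); near=> h; split.
    by near: h; exact: nbhs_left_lt.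
  split; first by near: h; apply: nbhs_left_gt; rewrite oppr_lt0.
  by near: h; exact: near_pos.
rewrite Dsj0 subr0 /GRing.scale/= mulr1 => h0 [sh].
rewrite nmulr_rgt0 ?invr_lt0//; apply/negP; rewrite -leNgt ltW// below//; lra.
Unshelve. all: end_near. Qed.

(** * The lattice equation *)

(** At a first contact point of w and v the pressures -1/w and -1/v agree while
    the neighbours are ordered, so the Laplacians are ordered too; the strict
    inequality between the source terms decides the sign of (v - w)'. *)
Lemma discrete_comparison (R : realType) n (T : R) (w v a b : R -> 'I_n -> R) :
  (forall x, {within `[0, T], continuous (w ^~ x)}) ->
  (forall x, {within `[0, T], continuous (v ^~ x)}) ->
  (forall t x, 0 <= t <= T -> 0 < w t x) ->
  (forall x, w 0 x < v 0 x) ->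
  (forall (t : R) x, 0 < t <= T -> is_derive t (1 : R) (w ^~ x)
     (laplacian (fun y => - (w t y)^-1) x + a t x)) ->
  (forall (t : R) x, 0 < t <= T -> is_derive t (1 : R) (v ^~ x)
     (laplacian (fun y => - (v t y)^-1) x + b t x)) ->
  (forall t x, 0 < t <= T -> a t x < b t x) ->
  forall t x, 0 <= t <= T -> w t x < v t x.
Proof.
move=> wc vc w0 wv dw dv ab t x tT; rewrite -subr_gt0.
apply: (first_touching (D := fun t x => v t x - w t x) (T := T) (dD := fun t x =>
  (laplacian (fun y => - (v t y)^-1) x + b t x) -
  (laplacian (fun y => - (w t y)^-1) x + a t x))) => //.
- by move=> i s; apply: continuousB; [exact: vc|exact: wc].
- by move=> i; rewrite subr_gt0.
- by move=> s i sT; apply: is_deriveB; [exact: dv|exact: dw].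
move=> s i sT Dge0 /eqP; rewrite subr_eq0 => /eqP vwi.
have w0' y : 0 < w s y by apply: w0; case/andP: sT => /ltW -> ->.
have mono y : - (w s y)^-1 <= - (v s y)^-1.
  have wvy : w s y <= v s y by rewrite -subr_ge0.
  by rewrite lerN2 lef_pV2// posrE// (lt_le_trans (w0' y)).
have lap_le : laplacian (fun y => - (w s y)^-1) i <= laplacian (fun y => - (v s y)^-1) i.
  rewrite /laplacian; apply: ler_wpM2l; first exact: exprn_ge0.
  by rewrite vwi; apply: lerB => //; apply: lerD.
have := ab s i sT; lra.
Qed.

(** phi_n(f) and - 1 / (f + n^-alpha) differ by the constant n^alpha, which the
    Laplacian kills. *)
Lemma laplacian_phin (R : realType) (alpha : R) n (f : 'I_n -> R) (x : 'I_n) :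
  (forall y, 0 <= f y) ->
  laplacian (fun y => phin alpha n (f y)) x =
  laplacian (fun y => - (f y + n%:R `^ (- alpha))^-1) x.
Proof.
move=> f0.
have N0 : 0 < (n%:R : R) `^ alpha by rewrite powR_gt0// ltr0n (leq_ltn_trans _ (ltn_ord x)).
have E y : phin alpha n (f y) = n%:R `^ alpha - (f y + n%:R `^ (- alpha))^-1.
  rewrite /phin /phi powRN; move: (n%:R `^ alpha) N0 (f0 y) => N N0 fy.
  have fN : 0 <= N * f y by rewrite mulr_ge0// ltW.
  by field; rewrite !gt_eqF//; lra.
rewrite /laplacian !E; ring.
Qed.

Lemma periodic_embed_ordS (R : realType) (f : R -> R) n (x : 'I_n) :
  periodic f 1 -> f (embed (ordS x)) = f (embed x + n%:R^-1).
Proof.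
move=> fp.
have n0 : (n%:R : R) != 0 by rewrite pnatr_eq0 -lt0n (leq_ltn_trans _ (ltn_ord x)).
have -> : embed x + n%:R^-1 = x.+1%:R / n%:R :> R.
  by rewrite /embed -[in RHS]addn1 natrD mulrDl mul1r.
rewrite /embed /=; have := ltn_ord x; rewrite leq_eqVlt => /orP[/eqP ->|xn].
  by rewrite modnn divff// mul0r -[in RHS](add0r 1) fp.
by rewrite modn_small.
Qed.

Lemma periodic_embed_ord_pred (R : realType) (f : R -> R) n (x : 'I_n) :
  periodic f 1 -> f (embed (ord_pred x)) = f (embed x - n%:R^-1).
Proof.
move=> fp; rewrite -[in RHS](ord_predK x).
have := @periodic_embed_ordS _ (fun y => f (y - n%:R^-1)) _ (ord_pred x).
by rewrite addrK => -> // y; rewrite addrAC fp.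
Qed.

Lemma embed_itv (R : realType) n (x : 'I_n) : 0 <= (embed x : R) <= 1.
Proof.
have xn := ltn_ord x.
have n0 : 0 < (n%:R : R) by rewrite ltr0n (leq_ltn_trans _ xn).
rewrite /embed divr_ge0//= ler_pdivrMr// mul1r ler_nat ltnW//.
Qed.

(** The comparison principle applies to v + n^-alpha, which is positive even
    where v vanishes. *)
Lemma shifted_ode (R : realType) (alpha : R) (u0 : R -> R) n (v : R -> 'I_n -> R) :
  ode_solution alpha u0 v ->
  let w := fun t x => v t x + n%:R `^ (- alpha) in
  [/\ forall x, {within `[0, 1], continuous (w ^~ x)},
      forall t x, 0 <= t <= 1 -> 0 < w t x &
      forall (t : R) x, 0 < t <= 1 -> is_derive t (1 : R) (w ^~ x)
        (laplacian (fun y => - (w t y)^-1) x + 0)].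
Proof.
move=> [v0 vc dv _] w; split.
- move=> x; apply: (@continuous_subspaceW R R `[0, 1] `[0, +oo[ (w ^~ x)).
    by move=> t /=; rewrite !in_itv/= => /andP[->].
  have cc : {within `[0, +oo[, continuous (cst (n%:R `^ (- alpha)) : R -> R)}.
    by apply: continuous_subspaceT => t; exact: cst_continuous.
  by move=> t; apply: continuousD (vc x t) (cc t).
- move=> t x /andP[t0 _]; apply: ltr_wpDl; first exact: v0.
  by rewrite powR_gt0// ltr0n (leq_ltn_trans _ (ltn_ord x)).
- move=> t x /andP[t0 _]; rewrite -laplacian_phin; last by move=> y; exact: v0 (ltW t0).
  exact: is_deriveD (dv t x t0) (is_derive_cst _ t 1).
Qed.

(** * The pressure of the limit equation *)

(** The pressure -1/u has spatial derivative u^-2 u_x, so the limit equation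
    reads (-1/u)_xx = u_t. *)
Lemma pressure_derivatives (R : realType) (u0 : R -> R) (u : R -> R -> R) (t : R) :
  pde_solution u0 u -> 0 < t ->
  exists2 q' : R -> R,
    forall x : R, is_derive x (1 : R) (fun y => - (u t y)^-1) (q' x) &
    forall x : R, is_derive x (1 : R) q' ((u ^~ x)^`() t).
Proof.
move=> [_ upos [_ [uder _]] upde _] t0.
exists (fun y => u t y ^- 2 * (u t)^`()%classic y) => x.
  have [_ ux _] := uder t x t0.
  have un0 : u t x != 0 by rewrite gt_eqF// upos// ltW.
  have dV := is_deriveV un0 (derivableP ux).
  by apply: is_derive_eq; rewrite derive1E scaleNr opprK.
have [_ ux uxx] := uder t x t0.
have un0 : u t x != 0 by rewrite gt_eqF// upos// ltW.
have dq' : derivable (fun y => u t y ^- 2 * (u t)^`()%classic y) x 1.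
  have dV : derivable (fun y => u t y ^- 2) x 1.
    apply: (@derivableV _ _ (fun y => u t y ^+ 2)).
      by rewrite expf_neq0.
    rewrite (_ : (fun y => _) = u t * u t); first exact: derivableM.
    by apply/funext => y; rewrite expr2.
  exact: (derivableM dV uxx).
by rewrite (upde t x t0) derive1E; exact: (derivableP dq').
Qed.

Lemma laplacian_pressure (R : realType) (u0 : R -> R) (u : R -> R -> R) n (t : R)
    (x : 'I_n) :
  pde_solution u0 u -> 0 < t ->
  exists2 xi, `|xi - embed x| <= n%:R^-1 &
    laplacian (fun y => - (u t (embed y))^-1) x = (u ^~ xi)^`() t.
Proof.
move=> usol t0; have [q' dq dq'] := pressure_derivatives usol t0.
have n0 : 0 < (n%:R : R) by rewrite ltr0n (leq_ltn_trans _ (ltn_ord x)).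
have uper : periodic (fun y => - (u t y)^-1) 1.
  by case: usol => /(_ t (ltW t0)) up _ _ _ _ y; rewrite up.
have n0V : 0 < (n%:R : R)^-1 by rewrite invr_gt0.
have [xi xix E] := second_difference_mean_value (embed x) n0V dq dq'.
exists xi => //; rewrite /laplacian (periodic_embed_ordS x uper).
rewrite (periodic_embed_ord_pred x uper) E mulrA -exprMn mulfV ?gt_eqF//.
by rewrite expr1n mul1r.
Qed.

(** * Rescaled solutions as barriers *)

Definition amplitude (R : realType) (eta t : R) : R := 1 + eta * (1 + t).

(** The solution of clock' = amplitude^-2 vanishing at 0. *)
Definition clock (R : realType) (eta t : R) : R :=
  t / ((1 + eta) * amplitude eta t).

Definition rescaled (R : realType) n (u : R -> R -> R) (delta eta t : R)
    (x : 'I_n) : R :=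
  amplitude eta t * u (delta + clock eta t) (embed x).

Lemma amplitude_bounds (R : realType) (eta t : R) :
  `|eta| <= 1 / 4 -> 0 <= t <= 1 -> 1 / 2 <= amplitude eta t <= 3 / 2.
Proof.
move=> eta4 t01.
move: eta4 t01; rewrite /amplitude ler_norml => /andP[? ?] /andP[? ?].
by apply/andP; split; nra.
Qed.

Lemma clock_bounds (R : realType) (eta t : R) :
  `|eta| <= 1 / 4 -> 0 <= t <= 1 -> 0 <= clock eta t <= 4.
Proof.
move=> eta4 t01.
have /andP[l1 l2] := amplitude_bounds eta4 t01.
move: eta4 t01; rewrite ler_norml => /andP[? ?] /andP[? ?].
have P : 3 / 8 <= (1 + eta) * amplitude eta t by nra.
rewrite /clock; apply/andP; split; first by apply: divr_ge0; lra.
by rewrite ler_pdivrMr; lra.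
Qed.

Lemma clock_close (R : realType) (eta t : R) :
  `|eta| <= 1 / 4 -> 0 <= t <= 1 -> `|clock eta t - t| <= 12 * `|eta|.
Proof.
move=> eta4 t01.
have /andP[l1 l2] := amplitude_bounds eta4 t01.
move: (eta4) t01; rewrite ler_norml => /andP[? ?] /andP[? ?].
have P : 3 / 8 <= (1 + eta) * amplitude eta t by nra.
have P0 : 0 < (1 + eta) * amplitude eta t by lra.
have -> : clock eta t - t =
    eta * (- t * (2 + t + eta * (1 + t)) / ((1 + eta) * amplitude eta t)).
  have e0 : 0 < 1 + eta by lra.
  have a0 : 0 < 1 + eta * (1 + t) by rewrite /amplitude in l1; lra.
  by rewrite /clock /amplitude; field; rewrite (gt_eqF e0) (gt_eqF a0).
rewrite normrM mulrC ler_wpM2r// normrM normfV (gtr0_norm P0) ler_pdivrMr//.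
rewrite ler_norml; apply/andP; split; nra.
Qed.

Lemma is_derive_clock (R : realType) (eta t : R) :
  `|eta| <= 1 / 4 -> 0 <= t <= 1 ->
  is_derive t (1 : R) (clock eta) (amplitude eta t ^- 2).
Proof.
move=> eta4 t01; have /andP[l1 l2] := amplitude_bounds eta4 t01.
move: eta4 t01; rewrite ler_norml => /andP[? ?] /andP[? ?].
have ln0 : (1 + eta) * amplitude eta t != 0 by rewrite mulf_neq0 ?gt_eqF//; lra.
have dl : is_derive t (1 : R) (fun s => (1 + eta) * amplitude eta s) ((1 + eta) * eta).
  by rewrite /amplitude; apply: is_derive_eq; rewrite /GRing.scale/=; ring.
have dV := @is_deriveV R (fun s => (1 + eta) * amplitude eta s) t _ 1 ln0 dl.
apply: is_derive_eq.
move: ln0; rewrite mulf_eq0 negb_or => /andP[e0 a0].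
rewrite /GRing.scale /=; move: a0; rewrite /amplitude => a0; field.
by rewrite e0 a0.
Qed.

(** The amplitude contributes eta u; the clock contributes u_t / l, which is also
    what the homogeneous flux gives for l u. *)
Lemma is_derive_rescaled (R : realType) (u0 : R -> R) (u : R -> R -> R)
    (delta eta t : R) n (x : 'I_n) :
  pde_solution u0 u -> 0 < delta -> `|eta| <= 1 / 4 -> 0 <= t <= 1 ->
  let s := delta + clock eta t in
  is_derive t (1 : R) (rescaled u delta eta ^~ x)
    (eta * u s (embed x) + (amplitude eta t)^-1 * (u ^~ (embed x))^`()%classic s).
Proof.
move=> usol d0 eta4 t01 s.
have /andP[l1 l2] := amplitude_bounds eta4 t01.
have /andP[c1 c2] := clock_bounds eta4 t01.
have s0 : 0 < s by rewrite /s; lra.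
have dc := is_derive_clock eta4 t01.
have ds : is_derive t (1 : R) (fun r => delta + clock eta r) (amplitude eta t ^- 2).
  by apply: (is_derive_eq (is_deriveD (is_derive_cst delta t 1) dc)); rewrite add0r.
have [_ _ [_ [uder _]] _ _] := usol.
have [ut _ _] := uder s (embed x) s0.
have du : is_derive s (1 : R) (u ^~ (embed x)) ((u ^~ (embed x))^`() s).
  by rewrite derive1E; apply: derivableP.
have dus := @is_derive1_comp R (u ^~ (embed x)) (fun r => delta + clock eta r) t _ _ du ds.
have dl : is_derive t (1 : R) (amplitude eta) eta.
  by rewrite /amplitude; apply: is_derive_eq; rewrite /GRing.scale/=; ring.
apply: (is_derive_eq (is_deriveM dl dus)).
rewrite /GRing.scale /= -/s; field; lra.
Qed.

(** The source term b is eta u plus the discretization error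
    (u_t(s, y) - u_t(s, xi)) / l with |xi - y| <= 1/n.  As 1/l <= 2, the bound on
    the oscillation of u_t keeps this error below |eta| m <= |eta| u, so b has the
    sign of eta. *)
Lemma rescaled_strict (R : realType) (u0 : R -> R) (u : R -> R -> R) n
    (delta eta m : R) :
  pde_solution u0 u -> 0 < delta <= 1 -> 0 < `|eta| <= 1 / 4 ->
  (forall s y, 0 <= s <= 5 -> 0 <= y <= 1 -> m <= u s y) ->
  (forall s y z, delta <= s <= 5 -> 0 <= y <= 1 -> `|z - y| <= n%:R^-1 ->
     `|(u ^~ y)^`()%classic s - (u ^~ z)^`()%classic s| < `|eta| * m / 2) ->
  exists2 b : R -> 'I_n -> R,
    forall (t : R) x, 0 < t <= 1 ->
      is_derive t (1 : R) (rescaled u delta eta ^~ x)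
        (laplacian (fun y => - (rescaled u delta eta t y)^-1) x + b t x) &
    forall t x, 0 < t <= 1 -> 0 < eta * b t x.
Proof.
move=> usol /andP[d0 d1] /andP[eta0 eta4] mu osc.
pose dv t (x : 'I_n) := let s := delta + clock eta t in
  eta * u s (embed x) + (amplitude eta t)^-1 * (u ^~ (embed x))^`()%classic s.
exists (fun t x => dv t x - laplacian (fun y => - (rescaled u delta eta t y)^-1) x).
  move=> t x /andP[t0 t1].
  by rewrite addrC subrK; apply: (is_derive_rescaled _ usol) => //; rewrite (ltW t0).
move=> t x /andP[t0 t1]; rewrite /dv /=; set s := delta + _.
have t01 : 0 <= t <= 1 by rewrite (ltW t0).
have /andP[c1 c2] := clock_bounds eta4 t01.
have /andP[l1 l2] := amplitude_bounds eta4 t01.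
have s0 : 0 < s by rewrite /s; lra.
have [xi xix E] := laplacian_pressure x usol s0.
have -> : laplacian (fun y => - (rescaled u delta eta t y)^-1) x =
    (amplitude eta t)^-1 * (u ^~ xi)^`()%classic s.
  rewrite -E /laplacian /rescaled -/s !invfM; ring.
have /andP[e0 e1] := @embed_itv R n x.
have mus : m <= u s (embed x) by apply: mu; rewrite ?e0//; apply/andP; split; rewrite /s; lra.
have := osc s _ _ _ _ xix; rewrite e0 e1 => /(_ _ isT) oscs.
have {oscs} : `|(u ^~ (embed x))^`()%classic s - (u ^~ xi)^`()%classic s| < `|eta| * m / 2.
  by apply: oscs; apply/andP; split; rewrite /s; lra.
set p := _^`()%classic _; set q := _^`()%classic _ => pq.
have lV : 0 < (amplitude eta t)^-1 <= 2.
  by rewrite invr_gt0 (lt_le_trans _ l1)//= invf_ple ?posrE//; lra.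
move: lV; set l := _^-1 => /andP[lV0 lV2].
have -> : eta * (eta * u s (embed x) + l * p - l * q) =
  eta ^+ 2 * u s (embed x) + eta * l * (p - q) by ring.
have B : `|eta * l * (p - q)| < eta ^+ 2 * m.
  rewrite 2!normrM (gtr0_norm lV0) -[eta ^+ 2]real_normK ?num_real//.
  apply: (@le_lt_trans _ _ (`|eta| * 2 * `|p - q|)).
    by rewrite ler_wpM2r// ler_wpM2l.
  have -> : `|eta| ^+ 2 * m = `|eta| * 2 * (`|eta| * m / 2) by field.
  by rewrite ltr_pM2l// mulr_gt0.
have : eta ^+ 2 * m <= eta ^+ 2 * u s (embed x) by rewrite ler_wpM2l// sqr_ge0.
move: B; rewrite ltr_norml => /andP[? ?]; lra.
Qed.

Lemma continuous_rescaled (R : realType) (u0 : R -> R) (u : R -> R -> R) n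
    (delta eta : R) (x : 'I_n) :
  pde_solution u0 u -> 0 < delta -> `|eta| <= 1 / 4 ->
  {within `[0, 1], continuous (rescaled u delta eta ^~ x)}.
Proof.
move=> usol d0 eta4; apply: continuous_in_subspaceT => t.
rewrite inE/= in_itv/= => t01.
have [+ _] := is_derive_rescaled x usol d0 eta4 t01.
by move=> /derivable1_diffP/differentiable_continuous.
Qed.

(** * Convergence *)

Lemma near_powRN_lt (R : realType) (alpha c : R) : 0 < alpha -> 0 < c ->
  \forall n \near \oo, (n%:R : R) `^ (- alpha) < c.
Proof.
move=> a0 c0; near=> n.
have cV0 : 0 < c^-1 by rewrite invr_gt0.
have nc : c^-1 `^ alpha^-1 < n%:R by near: n; exact: nbhs_infty_gtr.
have n0 : 0 < (n%:R : R) by rewrite (le_lt_trans _ nc)// powR_ge0.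
rewrite powRN invf_plt ?posrE ?powR_gt0//.
have := @gt0_ltr_powR _ _ a0 _ _ _ _ nc; rewrite -powRrM mulVf ?gt_eqF//.
by rewrite powRr1 ?ltW//; apply; rewrite nnegrE ?powR_ge0 ?ltW.
Unshelve. all: end_near. Qed.

Lemma pde_solution_unif (R : realType) (u0 : R -> R) (u : R -> R -> R) (b e : R) :
  pde_solution u0 u -> 0 < e ->
  exists2 d : R, 0 < d & forall s t x : R, 0 <= s <= b -> 0 <= t <= b -> 0 <= x <= 1 ->
    `|s - t| < d -> `|u s x - u t x| < e.
Proof.
move=> [_ _ [uc _] _ _] e0.
have cK : compact (`[0, b] `*` `[0, 1] : set (R * R)).
  by apply: compact_setX; exact: segment_compact.
have ucK : {within `[0, b] `*` `[0, 1], continuous (fun p : R * R => u p.1 p.2)}.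
  apply: continuous_subspaceW uc => p [/=].
  by rewrite in_itv/= => /andP[].
have [d d0 H] := compact_unif_continuous cK ucK e0.
exists d => // s t x sb tb x01 st; apply: (H (s, x) (t, x)).
- by split; rewrite /= in_itv.
- by split; rewrite /= in_itv.
- by split => //=; exact: ballxx.
Qed.

Lemma pde_solution_bounds (R : realType) (u0 : R -> R) (u : R -> R -> R) (b : R) :
  pde_solution u0 u -> 0 <= b ->
  exists m M : R, [/\ 0 < m, 0 < M &
    forall s x : R, 0 <= s <= b -> 0 <= x <= 1 -> m <= u s x <= M].
Proof.
move=> [_ upos [uc _] _ _] b0.
have cK : compact (`[0, b] `*` `[0, 1] : set (R * R)).
  by apply: compact_setX; exact: segment_compact.
have ucK : {within `[0, b] `*` `[0, 1], continuous (fun p : R * R => u p.1 p.2)}.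
  apply: continuous_subspaceW uc => p [/=].
  by rewrite in_itv/= => /andP[].
have K0 : (`[0, b] `*` `[0, 1] : set (R * R)) !=set0.
  by exists (0, 0); split; rewrite /= in_itv/= lexx ?b0//=.
have [p pK pmin] := compact_EVT_min K0 cK ucK.
have [q qK qmax] := compact_EVT_max K0 cK ucK.
have pos (r : R * R) : r \in `[0, b] `*` `[0, 1] -> 0 < u r.1 r.2.
  by rewrite inE => -[/=]; rewrite in_itv/= => /andP[+ _] _; exact: upos.
exists (u p.1 p.2), (u q.1 q.2); split; [exact: pos|exact: pos|].
move=> s x sb x01.
have sxK : (s, x) \in `[0, b] `*` `[0, 1] by rewrite inE; split; rewrite /= in_itv.
by rewrite (pmin _ sxK) (qmax _ sxK).
Qed.

(** The strip [-1, 2] contains every point at distance less than 1 from [0, 1],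
    so z may leave the fundamental domain. *)
Lemma time_derivative_unif (R : realType) (u0 : R -> R) (u : R -> R -> R)
    (delta b e : R) :
  pde_solution u0 u -> 0 < delta -> 0 < e ->
  exists2 d : R, 0 < d & forall s y z : R, delta <= s <= b -> 0 <= y <= 1 -> `|z - y| < d ->
    `|(u ^~ y)^`()%classic s - (u ^~ z)^`()%classic s| < e.
Proof.
move=> [_ _ [_ [_ uc]] _ _] d0 e0.
have cK : compact (`[delta, b] `*` `[-1, 2] : set (R * R)).
  by apply: compact_setX; exact: segment_compact.
have ucK : {within `[delta, b] `*` `[-1, 2],
    continuous (fun p : R * R => (u ^~ p.2)^`()%classic p.1)}.
  apply: continuous_in_subspaceT => p; rewrite inE => -[/=].
  rewrite in_itv/= => /andP[dp _] _.
  by case: (uc p (lt_le_trans d0 dp)).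
have [d dgt0 H] := compact_unif_continuous cK ucK e0.
exists (Num.min d 1); first by rewrite lt_min dgt0 ltr01.
move=> s y z sb /andP[y0 y1]; rewrite lt_min => /andP[yz yz1].
apply: (H (s, y) (s, z)).
- by split; rewrite /= in_itv//=; lra.
- split; rewrite /= in_itv//=.
  by move: yz1; rewrite ltr_norml => /andP[? ?]; apply/andP; split; lra.
- split => /=; first exact: ballxx.
  by rewrite -ball_normE /= distrC.
Qed.

(** The squeeze.  The constant eta is fixed first, from the size of u and its
    modulus of continuity; then delta, so that u(delta, .) approximates u_0 within
    eta m / 2; then n, which has to beat the oscillation of u_t after time delta
    and the shift n^-alpha.  Clocks stay in [0, 4], so u is only evaluated at
    times in [0, 5]. *)
Lemma uniform_convergence (R : realType) (alpha : R) (u0 : R -> R)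
    (un : forall n : nat, R -> 'I_n -> R) (u : R -> R -> R) (e : R) :
  0 < alpha -> (forall n : nat, ode_solution alpha u0 (un n)) ->
  pde_solution u0 u -> 0 < e ->
  \forall n \near \oo, forall (t : R) (x : 'I_n), 0 <= t <= 1 ->
    `|un n t x - u t (embed x)| <= e.
Proof.
move=> alpha0 unsol usol e0.
have [m [M [m0 M0 mM]]] := pde_solution_bounds usol (ler0n R 5).
have [|d1 d10 osc1] := @pde_solution_unif _ _ _ 5 (e / 4) usol; first lra.
pose eta := Num.min (1 / 4) (Num.min (e / (8 * M)) (d1 / 24)).
have eta0 : 0 < eta by rewrite !lt_min !divr_gt0// mulr_gt0.
have eta4 : eta <= 1 / 4 by rewrite ge_min lexx.
have etaM : eta * M <= e / 8.
  have : eta <= e / (8 * M) by rewrite !ge_min lexx orbT.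
  by rewrite invfM mulrA ler_pdivlMr.
have etad : 24 * eta <= d1.
  have : eta <= d1 / 24 by rewrite !ge_min lexx !orbT.
  lra.
have etam0 : 0 < eta * m / 2 by rewrite divr_gt0// mulr_gt0.
have [d2 d20 osc2] := pde_solution_unif 5 usol etam0.
pose delta := Num.min 1 (Num.min (d1 / 4) (d2 / 2)).
have delta0 : 0 < delta by rewrite !lt_min !divr_gt0// ltr01.
have delta1 : delta <= 1 by rewrite ge_min lexx.
have deltad1 : delta <= d1 / 4 by rewrite !ge_min lexx orbT.
have deltad2 : delta < d2.
  have : delta <= d2 / 2 by rewrite !ge_min lexx !orbT.
  lra.
have [d3 d30 osc3] := time_derivative_unif 5 usol delta0 etam0.
near=> n => t x t01.
have nd3 : (n%:R : R)^-1 < d3.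
  rewrite invf_plt ?posrE//; first by near: n; exact: nbhs_infty_gtr.
  by rewrite ltr0n (leq_ltn_trans _ (ltn_ord x)).
have Nlt1 : (n%:R : R) `^ (- alpha) < eta * m / 2.
  by near: n; exact: near_powRN_lt.
have Nlt2 : (n%:R : R) `^ (- alpha) < e / 4.
  by near: n; apply: near_powRN_lt => //; rewrite divr_gt0.
have N0 : 0 < (n%:R : R) `^ (- alpha).
  by rewrite powR_gt0// ltr0n (leq_ltn_trans _ (ltn_ord x)).
move: Nlt1 Nlt2 N0 (shifted_ode (unsol n)).
set N := n%:R `^ (- alpha) => Nlt1 Nlt2 N0 [/= wc w0 dw].
have initial (y : 'I_n) : `|u0 (embed y) - u delta (embed y)| < eta * m / 2.
  case: (usol) => _ _ _ _ <-; apply: osc2; rewrite ?lexx ?embed_itv//=.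
  + by rewrite (ltW delta0)/=; lra.
  + by rewrite sub0r normrN gtr0_norm.
have un0 (y : 'I_n) : un n 0 y = u0 (embed y) by case: (unsol n).
have clock0 (h : R) : clock h 0 = 0 by rewrite /clock mul0r.
have ud (y : 'I_n) : m <= u delta (embed y).
  have /mM/(_ (embed_itv R y))/andP[] // : 0 <= delta <= 5.
  by rewrite (ltW delta0); lra.
have strict (h : R) : `|h| = eta -> exists2 b : R -> 'I_n -> R,
    forall (t : R) x, 0 < t <= 1 ->
      is_derive t (1 : R) (rescaled u delta h ^~ x)
        (laplacian (fun y => - (rescaled u delta h t y)^-1) x + b t x) &
    forall t x, 0 < t <= 1 -> 0 < h * b t x.
  move=> hE; apply: (@rescaled_strict _ u0 _ _ _ _ m usol).
  + by rewrite delta0.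
  + by rewrite hE eta0.
  + by move=> s y s5 y1; case/andP: (mM s y s5 y1).
  + move=> s y z s5 y1 zy; rewrite hE; apply: osc3 => //.
    exact: le_lt_trans nd3.
(* Both barriers stay within e / 2 of u: e / 4 comes from the change of time,
   at most delta + 12 eta < d1, and e / 4 from the amplitude. *)
have close (h : R) : `|h| = eta ->
    `|rescaled u delta h t x - u t (embed x)| <= e / 2.
  move=> hE; have h4 : `|h| <= 1 / 4 by rewrite hE.
  have /andP[c1 c2] := clock_bounds h4 t01.
  have cc := clock_close h4 t01.
  have /andP[t0 t1] := t01.
  have s5 : 0 <= delta + clock h t <= 5 by apply/andP; split; lra.
  have /andP[_ uM] := mM _ _ s5 (embed_itv R x).
  have u0' : 0 <= u (delta + clock h t) (embed x).
    by have /andP[+ _] := mM _ _ s5 (embed_itv R x); apply: le_trans; exact: ltW.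
  have A : `|u (delta + clock h t) (embed x) - u t (embed x)| < e / 4.
    apply: osc1 => //; rewrite ?embed_itv//; first by rewrite t0; lra.
    have -> : delta + clock h t - t = delta + (clock h t - t) by ring.
    move: cc; rewrite hE => cc.
    by rewrite (le_lt_trans (ler_normD _ _))// (gtr0_norm delta0); lra.
  have -> : rescaled u delta h t x - u t (embed x) =
     (u (delta + clock h t) (embed x) - u t (embed x)) +
     h * ((1 + t) * u (delta + clock h t) (embed x)).
    by rewrite /rescaled /amplitude; ring.
  have B : `|h * ((1 + t) * u (delta + clock h t) (embed x))| <= e / 4.
    rewrite normrM hE ger0_norm; last by rewrite mulr_ge0//; lra.
    apply: (@le_trans _ _ (eta * (2 * M))); last lra.
    by rewrite ler_wpM2l ?(ltW eta0)// ler_pM//; lra.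
  by rewrite (le_trans (ler_normD _ _))//; lra.
have n_eta : `|eta| = eta by rewrite gtr0_norm.
have n_Neta : `|- eta| = eta by rewrite normrN.
have upper : un n t x + N < rescaled u delta eta t x.
  have [b db b0] := strict _ n_eta.
  apply: (@discrete_comparison _ _ 1 (fun t x => un n t x + N) _ (fun _ _ => 0) b) => //.
  + by move=> y; apply: continuous_rescaled usol _ _ => //; rewrite n_eta.
  + move=> y; rewrite un0 /rescaled clock0 addr0 /amplitude addr0 mulr1.
    have := initial y; have := ud y; rewrite ltr_norml => ? /andP[? ?]; nra.
  + by move=> s y s01; have := b0 s y s01; rewrite pmulr_rgt0.
have lower : rescaled u delta (- eta) t x < un n t x + N.
  have [b db b0] := strict _ n_Neta.
  apply: (@discrete_comparison _ _ 1 _ (fun t x => un n t x + N) b (fun _ _ => 0)) => //.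
  + by move=> y; apply: continuous_rescaled usol _ _ => //; rewrite n_Neta.
  + move=> s y s01; have Ne4 : `|- eta| <= 1 / 4 by rewrite n_Neta.
    have /andP[c1 c2] := clock_bounds Ne4 s01.
    have /andP[l1 l2] := amplitude_bounds Ne4 s01.
    have s5 : 0 <= delta + clock (- eta) s <= 5 by apply/andP; split; lra.
    have /andP[mu _] := mM _ _ s5 (embed_itv R y).
    by rewrite /rescaled mulr_gt0//; lra.
  + move=> y; rewrite un0 /rescaled clock0 addr0 /amplitude addr0 mulr1.
    have := initial y; have := ud y; rewrite ltr_norml => ? /andP[? ?]; nra.
  + by move=> s y s01; have := b0 s y s01; rewrite mulNr oppr_gt0 pmulr_rlt0.
have := close _ n_eta; have := close _ n_Neta.
rewrite !ler_norml => /andP[? ?] /andP[? ?]; lra.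
Unshelve. all: end_near. Qed.

Theorem theorem2p3 (R : realType) (alpha : R) (u0 : R -> R)
    (halpha : 0 < alpha)
    (u0_periodic : periodic u0 1)
    (u0_C2 : C2 u0)
    (u0_ge : exists2 eps : R, 0 < eps & forall x, eps <= u0 x) :
  exists2 T : R, 0 < T &
    forall (un : forall n : nat, R -> 'I_n -> R) (u : R -> R -> R),
      (forall n : nat, ode_solution alpha u0 (un n)) ->
      pde_solution u0 u ->
      ereal_sup (range (fun x : 'I_n =>
        ereal_sup [set (`|un n t x - u t (embed x)|)%:E | t in `[0, T]]))
        @[n --> \oo] --> 0%E.
Proof.
exists 1 => // un u unsol usol.
set S := fun n => ereal_sup _.
have S_le e : 0 < e -> \forall n \near \oo, (0 <= S n <= e%:E)%E.
  move=> e0; near=> n.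
  have n0 : (0 < n)%N by near: n; exact: nbhs_infty_gt.
  apply/andP; split.
    apply: le_ereal_sup_tmp; exists (ereal_sup [set (`|un n t (Ordinal n0) -
        u t (embed (Ordinal n0))|)%:E | t in `[0, 1]]); first by exists (Ordinal n0).
    apply: le_ereal_sup_tmp.
    exists (`|un n 0 (Ordinal n0) - u 0 (embed (Ordinal n0))|)%:E.
      by exists 0 => //=; rewrite in_itv/= lexx ler01.
    by rewrite lee_fin.
  apply: ge_ereal_sup => _ [x _ <-]; apply: ge_ereal_sup => _ [t /= t01 <-].
  rewrite lee_fin; move: t x t01; near: n.
  have := uniform_convergence halpha unsol usol e0.
  by apply: filterS => n H t x; rewrite in_itv/=; exact: H.
apply/fine_cvgP; split.
  have := S_le 1 ltr01; apply: filterS => n /andP[S0 S1].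
  by rewrite ge0_fin_numE// (le_lt_trans S1)// ltry.
apply/cvgr0Pnorm_le => e e0; have := S_le e e0.
apply: filterS => n /andP[S0 Se] /=.
have Sfin : S n \is a fin_num by rewrite ge0_fin_numE// (le_lt_trans Se)// ltry.
by rewrite ger0_norm ?fine_ge0// -lee_fin fineK.
Unshelve. all: end_near. Qed.
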